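(* Let $T$ be a tree with $n$ vertices and odd diameter $d\geq 5$, and let $\rho=\varepsilon_1(T)$. Then $$\rho\leq \max\Big\{\varepsilon_1(D_{n,d}^{0, n-d-1}),\ \varepsilon_1(D_{n,d}^{\lfloor\frac{n-d-1}{2}\rfloor, \lceil\frac{n-d-1}{2}\rceil})\Big\},$$ with equality only if $T\cong D_{n,d}^{0, n-d-1}$ or $T\cong D_{n,d}^{\lfloor\frac{n-d-1}{2}\rfloor, \lceil\frac{n-d-1}{2}\rceil}$.
   Context: All graphs are finite, simple and connected. For a graph $G$, $d_G(u,v)$ is the distance and $e_G(u)=\max_{v} d_G(u,v)$ the eccentricity. The eccentricity matrix $\varepsilon(G)$ is the symmetric matrix indexed by $V(G)$ with $(\varepsilon(G))_{uv}=d_G(u,v)$ if $d_G(u,v)=\min\{e_G(u),e_G(v)\}$ and $(\varepsilon(G))_{uv}=0$ otherwise; $\varepsilon_1(G)$ denotes its largest eigenvalue. For odd $d\geq 3$ and integers $b\geq a\geq 0$ with $a+b=n-d-1$, $D_{n,d}^{a,b}$ is the tree obtained from the path $v_0v_1\cdots v_d$ by attaching $a$ pendant vertices to $v_1$ and $b$ pendant vertices to $v_{d-1}$. *)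

(* Defs.v *)
From mathcomp Require Import all_boot all_order all_algebra.
From mathcomp Require Import classical_sets reals.

Set Implicit Arguments.
Unset Strict Implicit.
Unset Printing Implicit Defensive.

Record sgraph (V : finType) := SGraph {
  adj : rel V;
  adj_sym : symmetric adj;
  adj_irr : irreflexive adj }.

Section Graph.
Variables (V : finType) (G : sgraph V).

Definition connected : Prop :=
  0 < #|V| /\ forall u v : V, connect (adj G) u v.

(* Cycles have at least three vertices; [ucycleb] alone would accept an edge
   traversed back and forth. *)
Definition acyclic : Prop :=
  forall c : seq V, 2 < size c -> ~~ ucycleb (adj G) c.

Definition is_tree : Prop := connected /\ acyclic.

Definition walk_of_length (u v : V) (k : nat) : bool :=
  [exists p : k.-tuple V, path (adj G) u p && (last u p == v)].

(* Least length of a walk from u to v. A shortest walk has length < #|V|; the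
   value is #|V| (by convention of [find]) when v is not reachable from u,
   which does not occur in connected graphs. *)
Definition dist (u v : V) : nat := find (walk_of_length u v) (iota 0 #|V|).

Definition ecc (u : V) : nat := \max_(v : V) dist u v.

Definition diam : nat := \max_(u : V) ecc u.

Local Open Scope ring_scope.

(* Rows and columns are indexed by V through its enumeration. *)
Definition ecc_matrix (R : realType) : 'M[R]_#|V| :=
  \matrix_(i, j)
    let u := enum_val i in
    let v := enum_val j in
    if dist u v == minn (ecc u) (ecc v) then (dist u v)%:R else 0.

(* The set of eigenvalues is finite, and nonempty when V is nonempty because the
   matrix is real symmetric, so the supremum is its largest element. *)
Definition ecc_spectral_max (R : realType) : R :=
  sup [set x : R | eigenvalue (ecc_matrix R) x]%classic.

End Graph.

Definition isomorphic (V W : finType) (G : sgraph V) (H : sgraph W) : Prop :=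
  exists2 f : V -> W, bijective f & forall x y, adj H (f x) (f y) = adj G x y.

Section DoubleBroom.
Variables d a b : nat.

(* [inl (inl i)] is the path vertex v_i, [inl (inr _)] are the pendant vertices
   at v_1 and [inr _] those at v_(d-1). *)
Definition D_vertex : finType := ('I_d.+1 + 'I_a + 'I_b)%type.

Definition D_arc (x y : D_vertex) : bool :=
  match x, y with
  | inl (inl i), inl (inl j) => i.+1 == j
  | inl (inl i), inl (inr _) => (i : nat) == 1
  | inl (inl i), inr _ => (i : nat) == d.-1
  | _, _ => false
  end.

Definition D_adj : rel D_vertex := [rel x y | D_arc x y || D_arc y x].

Fact D_adj_sym : symmetric D_adj.
Proof. by move=> x y; rewrite /D_adj /= orbC. Qed.

Fact D_adj_irr : irreflexive D_adj.
Proof. by case=> [[i|i]|i] //; rewrite /D_adj /= orbb gtn_eqF. Qed.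

(* The order n is determined: #|D_vertex| = d + 1 + a + b. *)
Definition D : sgraph D_vertex := SGraph D_adj_sym D_adj_irr.

End DoubleBroom.

(* Main.v *)
(* Write [d = 2r + 1].  A tree of diameter [d] splits along its central edge into two halves,
   and the eccentricity matrix only sees the depths: its nonzero entries join vertices of
   opposite halves one of which has maximal depth.  If [p], [q] count the deepest vertices of
   the two halves and [SA], [SB] are the sums of the squared eccentricities of the other
   vertices, then the square of the largest eigenvalue is the larger root of
   [(l - p SB) (l - q SA) = d^2 p q l].  Turning a shallow superfluous vertex into a deepest one
   of the same half strictly increases this root, so one may take [SA = SB = S], the value for
   double brooms.  With [s = p + q] fixed, the root is then strictly monotone in [p q],
   increasing if [s d^2 > S] and decreasing if [s d^2 < S]; equality never occurs because
   [d^2] times an integer [s >= 2] cannot be [S].  Hence the extremes are [p = 1] and [p], [q]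
   balanced. *)
Require Import Defs.
From mathcomp Require Import all_boot all_order all_algebra.
From mathcomp Require Import boolp classical_sets reals.
From mathcomp Require Import zify ring lra.

Set Implicit Arguments.
Unset Strict Implicit.
Unset Printing Implicit Defensive.

(** * Walks and distances *)

Section Walks.
Variables (V : finType) (G : sgraph V).

Lemma walkP (u v : V) (k : nat) :
  reflect (exists p, [/\ path (adj G) u p, last u p = v & size p = k])
          (walk_of_length G u v k).
Proof.
apply: (iffP existsP) => [[p /andP[pp /eqP lp]]|[p [pp lp sp]]].
  by exists p; split=> //; rewrite size_tuple.
by exists (tcast sp (in_tuple p)); rewrite val_tcast pp lp eqxx.
Qed.

Lemma walk0 u : walk_of_length G u u 0.
Proof. by apply/walkP; exists [::]. Qed.

Lemma walk1 u v : adj G u v -> walk_of_length G u v 1.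
Proof. by move=> uv; apply/walkP; exists [:: v]; rewrite /= uv. Qed.

Lemma walk_trans u v w k l : walk_of_length G u v k ->
  walk_of_length G v w l -> walk_of_length G u w (k + l).
Proof.
move=> /walkP[p [pp lp sp]] /walkP[q [pq lq sq]].
by apply/walkP; exists (p ++ q); rewrite cat_path last_cat size_cat lp pp sp sq.
Qed.

Lemma walk_sym u v k : walk_of_length G u v k -> walk_of_length G v u k.
Proof.
move=> /walkP[p [pp lp sp]]; apply/walkP; exists (rev (belast u p)); split.
- by rewrite -lp rev_path (eq_path (e' := adj G)) // => x y; rewrite /= adj_sym.
- by case: p {sp pp} lp => //= x p _; rewrite rev_cons last_rcons.
- by rewrite size_rev size_belast.
Qed.

Lemma walk_step u v k : walk_of_length G u v k.+1 ->
  exists2 w, adj G u w & walk_of_length G w v k.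
Proof.
move=> /walkP[[|w p] [] //= /andP[uw pp] lp [sp]].
by exists w => //; apply/walkP; exists p.
Qed.

Lemma dist_le u v k : walk_of_length G u v k -> dist G u v <= k.
Proof.
move=> wk; rewrite /dist; have [kV|Vk] := ltnP k #|V|; last first.
  by apply: leq_trans Vk; rewrite -[X in _ <= X](size_iota 0) find_size.
rewrite leqNgt; apply/negP => /(before_find 0).
by rewrite nth_iota // add0n wk.
Qed.

Lemma dist_id u : dist G u u = 0.
Proof. by apply/eqP; rewrite -leqn0; apply/dist_le/walk0. Qed.

(** Shortening a walk to a duplicate-free path keeps its length below [#|V|], so the search defining
    [dist] succeeds. *)
Lemma walk_dist u v : connect (adj G) u v -> walk_of_length G u v (dist G u v).
Proof.
move=> /connectP[p pp lp]; rewrite /dist.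
case/shortenP: pp lp => q pq uq _ lq.
have sq : size q < #|V|.
  by rewrite -[(size q).+1]/(size (u :: q)) -(card_uniqP uq) max_card.
have hq : has (walk_of_length G u v) (iota 0 #|V|).
  apply/hasP; exists (size q); first by rewrite mem_iota.
  by apply/walkP; exists q.
have := nth_find 0 hq; rewrite nth_iota ?add0n //.
by rewrite has_find size_iota in hq.
Qed.

End Walks.

Section ConnectedDist.
Variables (V : finType) (G : sgraph V).
Hypothesis conG : forall u v : V, connect (adj G) u v.

Lemma dist_walk u v : walk_of_length G u v (dist G u v).
Proof. exact: walk_dist. Qed.

Lemma distC u v : dist G u v = dist G v u.
Proof.
by apply/eqP; rewrite eqn_leq !dist_le // walk_sym // dist_walk.
Qed.

Lemma dist_triangle u v w : dist G u w <= dist G u v + dist G v w.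
Proof. by apply: dist_le; apply: walk_trans (dist_walk _ _) (dist_walk _ _). Qed.

Lemma dist_eq0 u v : dist G u v = 0 -> u = v.
Proof. by move=> e; have := dist_walk u v; rewrite e => /walkP[[|x p] []]. Qed.

Lemma dist_adj u v : adj G u v -> dist G u v <= 1.
Proof. by move=> uv; apply/dist_le/walk1. Qed.

Lemma dist_pred u v k : dist G u v = k.+1 ->
  exists2 w, adj G u w & dist G w v = k.
Proof.
move=> e; have := dist_walk u v; rewrite e => /walk_step[w uw ww].
exists w => //; apply/eqP; rewrite eqn_leq dist_le //=.
by have := dist_triangle u w v; have := dist_adj uw; lia.
Qed.

Lemma leq_dist_ecc u v : dist G u v <= ecc G u.
Proof. exact: (leq_bigmax (F := fun v => dist G u v)). Qed.

Lemma leq_ecc_diam u : ecc G u <= diam G.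
Proof. exact: (leq_bigmax (F := fun u => ecc G u)). Qed.

Lemma diam_attained : 0 < #|V| -> exists u v, dist G u v = diam G.
Proof.
move=> V0; case: (eq_bigmax (fun u => ecc G u) V0) => u eu.
by case: (eq_bigmax (fun v => dist G u v) V0) => v ev; exists u, v; rewrite /diam eu /ecc ev.
Qed.

End ConnectedDist.

(** * Levels of a tree of odd diameter *)

Section Leveling.
Variables (V : finType) (G : sgraph V) (r : nat) (lev : V -> nat).

(* [lev] is the position along a diametral path [v_0 ... v_d], [d = 2r+1]: a vertex whose
   nearest centre is [v_r] (resp. [v_(r+1)]) at distance [h] has level [r - h]
   (resp. [r + 1 + h]). *)
Record leveling : Prop := Leveling {
  lev_le : forall v, lev v <= r.*2.+1;
  lev_adj : forall u v, adj G u v -> lev v = (lev u).+1 \/ lev u = (lev v).+1;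
  lev_up : forall v, lev v <= r -> exists2 w, adj G v w & lev w = (lev v).+1;
  lev_down : forall v, r < lev v -> exists2 w, adj G v w & lev v = (lev w).+1;
  lev_center : forall u v, lev u = lev v -> r <= lev u <= r.+1 -> u = v;
  lev_bot : exists v, lev v = 0;
  lev_top : exists v, lev v = r.*2.+1 }.

End Leveling.

(** * Existence of a leveling *)

Section TreeLeveling.
Variables (V : finType) (G : sgraph V).
Hypotheses (conG : forall u v : V, connect (adj G) u v) (acG : acyclic G).

Definition del_edge (x y : V) : rel V :=
  [rel u v | adj G u v && ~~ ((u == x) && (v == y) || (u == y) && (v == x))].

Lemma del_edge_sym x y : symmetric (del_edge x y).
Proof.
move=> u v; rewrite /del_edge /= adj_sym orbC andbC [X in _ || X]andbC.
by rewrite [_ && (u == y)]andbC andbC.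
Qed.

(** A duplicate-free path avoiding the edge has at least two steps, and closing it by the edge gives
    a cycle on at least three vertices. *)
Lemma bridge x y : adj G x y -> ~~ connect (del_edge x y) x y.
Proof.
move=> xy; apply/negP => /connectP[p pp lp].
case/shortenP: pp lp => q pq uq _ lq.
have pq' : path (adj G) x q by apply: sub_path pq => u v /andP[].
case: q lq pq uq pq' => [|z q].
  by move=> /= e; move: xy; rewrite e adj_irr.
case: q => [|z' q] lq pq uq pq'.
  by move: lq pq => /= <-; rewrite /del_edge /= !eqxx /= andbF.
have /negP[] := @acG (x :: z :: z' :: q) isT.
rewrite /ucycleb uq andbT (cycle_path x) -[last x (x :: _)]/(last x [:: z, z' & q]) -lq.
by apply/andP; split; first by rewrite adj_sym.
Qed.

(* If [u] and [v] were equidistant from [c], geodesics to [c] would avoid the edge [uv],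
   which is a bridge. *)
Lemma tree_adj_dist u v c : adj G u v ->
  dist G u c = (dist G v c).+1 \/ dist G v c = (dist G u c).+1.
Proof.
move=> uv.
have h1 := dist_triangle conG u v c; have h2 := dist_triangle conG v u c.
have h3 := dist_adj uv; have h4 : dist G v u <= 1 by apply: dist_adj; rewrite adj_sym.
have [e|ne] := eqVneq (dist G u c) (dist G v c); last by lia.
have desc k : forall w, dist G w c = k -> k <= dist G u c -> connect (del_edge u v) w c.
  elim: k => [|k IH] w wk ku; first by rewrite (dist_eq0 conG wk).
  have [z wz zk] := dist_pred conG wk.
  apply: connect_trans (IH z zk (ltnW ku)); apply: connect1.
  rewrite /del_edge /= wz /=; apply/negP => /orP[] /andP[/eqP E1 /eqP E2]; subst w z; lia.
have /negP[] := bridge uv.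
apply: connect_trans (desc _ u erefl (leqnn _)) _.
by rewrite (sym_connect_sym (@del_edge_sym _ _)) (desc _ v erefl) ?e.
Qed.

Section Crossing.
Variables c1 c2 : V.
Hypothesis c12 : adj G c1 c2.
Let A := [pred v | connect (del_edge c1 c2) c1 v].

Lemma c1_side : c1 \in A. Proof. exact: connect0. Qed.

Lemma c2_side : c2 \notin A. Proof. exact: bridge. Qed.

(** Every other edge leaving [A] survives in [del_edge c1 c2], so its far end would still be
    reachable from [c1]. *)
Lemma cross_edge u v : u \in A -> v \notin A -> adj G u v -> u = c1 /\ v = c2.
Proof.
move=> uA vA uv; have : ~~ del_edge c1 c2 u v.
  apply: contra vA => uv'; rewrite inE; apply: connect_trans (connect1 uv').
  by move: uA; rewrite inE.
rewrite /del_edge /= uv /= negbK => /orP[] /andP[/eqP E1 /eqP E2] //.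
by subst u; move: c2_side; rewrite uA.
Qed.

(** For the lower bound, follow a geodesic from [v] until it first leaves [A]; it can do so only
    along the edge from [c1] to [c2]. *)
Lemma cross_dist v w : v \in A -> w \notin A ->
  dist G v w = dist G v c1 + (dist G c2 w).+1.
Proof.
move=> vA wA; apply/eqP; rewrite eqn_leq; apply/andP; split.
  apply: leq_trans (dist_triangle conG v c1 w) _; rewrite leq_add2l.
  apply: leq_trans (dist_triangle conG c1 c2 w) _; rewrite -add1n leq_add2r.
  exact: dist_adj.
have /walkP[p [pp lp <-]] := dist_walk conG v w.
elim: p v vA pp lp => [|x p IH] v vA /=; first by move=> _ e; move: wA; rewrite -e vA.
move=> /andP[vx px] lp; have [xA|xA] := boolP (x \in A).
  have := IH x xA px lp; have := dist_triangle conG v x c1; have := dist_adj vx; lia.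
have [vc xc] := cross_edge vA xA vx; rewrite vc dist_id add0n ltnS -xc.
by apply: dist_le; apply/walkP; exists p.
Qed.

End Crossing.

Lemma tree_leveling r : 0 < #|V| -> diam G = r.*2.+1 -> exists lev, leveling G r lev.
Proof.
move=> V0 dG; have [a [b]] := diam_attained G V0; rewrite dG => ab.
have := dist_walk conG a b; rewrite ab => /walkP[p [pp lp sp]].
have dle u v : dist G u v <= r.*2.+1.
  by rewrite -dG; apply: leq_trans (leq_dist_ecc _ _ _) (leq_ecc_diam _ _).
(* [c1] lies [r] steps along a diametral path; the two pieces have lengths at most [r] and [r + 1],
   and the triangle inequality forces equality. *)
have [c1 [ac1 c1b]] : exists c, dist G a c = r /\ dist G c b = r.+1.
  pose q := take r p; have eq := cat_take_drop r p.
  exists (last a q).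
  have h1 : dist G a (last a q) <= r.
    apply: dist_le; apply/walkP; exists q; rewrite size_take sp.
    move: pp; rewrite -eq cat_path => /andP[-> _]; split => //.
    case: ltnP => //; lia.
  have h2 : dist G (last a q) b <= r.+1.
    apply: dist_le; apply/walkP; exists (drop r p); rewrite size_drop sp.
    move: pp lp; rewrite -{1 2}eq cat_path last_cat => /andP[_ ->] ->; split=> //; lia.
  by have := dist_triangle conG a (last a q) b; lia.
have [c2 c12 c2b] := dist_pred conG c1b.
have ac2 : r.+1 <= dist G a c2 by have := dist_triangle conG a c2 b; lia.
pose A := [pred v | connect (del_edge c1 c2) c1 v].
have A1 : c1 \in A := c1_side c1 c2; have A2 : c2 \notin A := c2_side c12.
have d12 : dist G c1 c2 = 1.
  by have := dist_adj c12; have := dist_triangle conG a c1 c2; lia.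
have aA : a \in A.
  apply/negPn/negP => aA; have := cross_dist c12 A1 aA.
  rewrite dist_id (distC conG c1) (distC conG c2); lia.
have bA : b \notin A.
  apply/negP => bA; have := cross_dist c12 bA A2.
  rewrite dist_id (distC conG b) (distC conG b); lia.
(* The ends [a], [b] lie on opposite sides, and distances across the central edge are at most
   [2r + 1], which bounds the depth of each half by [r]. *)
have hA v : v \in A -> dist G v c1 <= r.
  by move=> vA; have := cross_dist c12 vA bA; have := dle v b; lia.
have hB v : v \notin A -> dist G v c1 = (dist G v c2).+1 /\ dist G v c1 <= r.+1.
  move=> vA; have := cross_dist c12 aA vA; have := cross_dist c12 A1 vA.
  rewrite dist_id (distC conG c1) (distC conG c2); have := dle a v; lia.
(* On the side of [c2] the distance to [c1] includes the central edge, so [c2] gets level [r + 1];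
   on the other side the subtraction does not truncate, by [hA]. *)
exists (fun v => if v \in A then r - dist G v c1 else r + dist G v c1).
split.
- by move=> v; case: ifPn => [_|/hB[_]]; clear; lia.
- move=> u v uv; have vu : adj G v u by rewrite adj_sym.
  case: ifPn => vA; case: ifPn => uA.
  + by move: (hA _ vA) (hA _ uA) (tree_adj_dist c1 uv); clear; lia.
  + have [-> ->] := cross_edge c12 vA uA vu.
    by rewrite dist_id (distC conG c2) d12; clear; lia.
  + have [-> ->] := cross_edge c12 uA vA uv.
    by rewrite dist_id (distC conG c2) d12; clear; lia.
  + by move: (tree_adj_dist c1 uv); clear; lia.
- move=> v; case: ifPn => vA.
    move=> _; case e: (dist G v c1) => [|k].
      have -> := dist_eq0 conG e; exists c2 => //.
      by rewrite (negPf A2) (distC conG c2) d12; clear; lia.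
    have [w vw wk] := dist_pred conG e; exists w => //.
    have wA : w \in A.
      apply/negPn/negP => wA; have [vc _] := cross_edge c12 vA wA vw.
      by move: e; rewrite vc dist_id.
    by move: (hA _ vA); rewrite wA wk e; clear; lia.
  by have [-> _] := hB v vA; clear; lia.
- move=> v; case: ifPn => vA; first by clear; lia.
  have [h1 h2] := hB v vA; move=> _.
  have [w vw wk] := dist_pred conG h1; exists w => //.
  have [wA|wA] := boolP (w \in A); last by rewrite h1 wk addnS.
  have [-> vc] := cross_edge c12 wA vA (etrans (adj_sym _ _ _) vw).
  by rewrite vc dist_id (distC conG c2) d12 subn0 addn1.
- have uniq1 v : v \in A -> r - dist G v c1 = r -> v = c1.
    by move=> vA e; apply: (dist_eq0 conG); move: e (hA _ vA); clear; lia.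
  have uniq2 v : v \notin A -> r + dist G v c1 = r.+1 -> v = c2.
    by move=> vA e; apply: (dist_eq0 conG); move: e (hB _ vA); clear; lia.
  move=> u v; case: ifPn => uA; case: ifPn => vA e h.
  + by rewrite (uniq1 u uA) 1?(uniq1 v vA) //; move: e h; clear; lia.
  + by exfalso; move: e h (hB _ vA); clear; lia.
  + by exfalso; move: e h (hB _ uA); clear; lia.
  + by rewrite (uniq2 u uA) 1?(uniq2 v vA) //; move: e h (hB _ vA) (hB _ uA); clear; lia.
- by exists a; rewrite aA ac1 subnn.
- by exists b; rewrite (negPf bA) (distC conG) c1b -addnn addnS.
Qed.

End TreeLeveling.

(** * The eccentricity matrix in terms of levels *)

Section LevelDist.
Variables (V : finType) (G : sgraph V) (r : nat) (lev : V -> nat).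
Hypothesis L : leveling G r lev.

(** The two halves change roles, so facts about the lower half carry over to the upper one. *)
Lemma leveling_rev : leveling G r (fun v => r.*2.+1 - lev v).
Proof.
have le := lev_le L; split.
- by move=> v; rewrite leq_subr.
- by move=> u v /(lev_adj L); have := le u; have := le v; lia.
- move=> v h; have [|w vw e] := lev_down L (v := v); first by have := le v; lia.
  by exists w => //; have := le v; lia.
- move=> v h; have [|w vw e] := lev_up L (v := v); first by have := le v; lia.
  by exists w => //; have := le w; lia.
- by move=> u v e h; apply: (lev_center L); have := le v; have := le u; lia.
- by have [v e] := lev_top L; exists v; lia.
- by have [v e] := lev_bot L; exists v; lia.
Qed.

Lemma walk_to_level k u : lev u <= k <= r.+1 ->
  exists2 c, lev c = k & walk_of_length G u c (k - lev u).
Proof.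
elim: k => [|k IH] /andP[h1 h2].
  by exists u; [lia | rewrite sub0n walk0].
have [e|ne] := eqVneq (lev u) k.+1; first by exists u => //; rewrite e subnn walk0.
have [|c ck wc] := IH _; first by lia.
have [|w cw ew] := lev_up L (v := c); first by lia.
exists w; first by lia.
have -> : k.+1 - lev u = (k - lev u) + 1 by lia.
exact: walk_trans wc (walk1 cw).
Qed.

(** Both vertices climb to level [r], where [lev_center] leaves only one vertex. *)
Lemma walk_lo_lo u v : lev u <= r -> lev v <= r ->
  walk_of_length G u v ((r - lev u) + (r - lev v)).
Proof.
move=> hu hv.
have [|c ec wc] := @walk_to_level r u; first by lia.
have [|c' ec' wc'] := @walk_to_level r v; first by lia.
have cc : c = c' by apply: (lev_center L); lia.
by apply: walk_trans wc _; rewrite cc walk_sym.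
Qed.

End LevelDist.

Section LevelMatrix.
Variables (V : finType) (G : sgraph V) (r : nat) (lev : V -> nat).
Hypothesis L : leveling G r lev.
Let d := r.*2.+1.

Lemma walk_hi_hi u v : r < lev u -> r < lev v ->
  walk_of_length G u v ((lev u - r.+1) + (lev v - r.+1)).
Proof.
move=> hu hv; have [lu lv] := (lev_le L u, lev_le L v).
have := @walk_lo_lo _ _ _ _ (leveling_rev L) u v.
have -> : r - (r.*2.+1 - lev u) = lev u - r.+1 by lia.
have -> : r - (r.*2.+1 - lev v) = lev v - r.+1 by lia.
by apply; lia.
Qed.

Lemma walk_lo_hi u v : lev u <= r -> r < lev v ->
  walk_of_length G u v (lev v - lev u).
Proof.
move=> hu hv; have lv := lev_le L v.
have [|c ec wc] := @walk_to_level _ _ _ _ L r.+1 u; first by lia.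
have wcv : walk_of_length G c v (lev v - r.+1).
  by have := @walk_hi_hi c v; rewrite ec subnn add0n; apply; lia.
have -> : lev v - lev u = (r.+1 - lev u) + (lev v - r.+1) by lia.
exact: walk_trans wc wcv.
Qed.

Lemma leveling_connected u v : connect (adj G) u v.
Proof.
have [k /walkP[p [pp lp _]]] : exists k, walk_of_length G u v k.
  have [hu|hu] := leqP (lev u) r; have [hv|hv] := leqP (lev v) r; eexists.
  - exact: (walk_lo_lo L).
  - exact: walk_lo_hi.
  - exact/walk_sym/walk_lo_hi.
  - exact: walk_hi_hi.
by apply/connectP; exists p.
Qed.

Lemma lev_dist u v : lev v <= lev u + dist G u v.
Proof.
have /walkP[p [pp lp <-]] := walk_dist (leveling_connected u v).
elim: p u pp lp => [|x p IH] u /=; first by move=> _ ->; lia.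
by move=> /andP[/(lev_adj L) ux /IH h /h]; lia.
Qed.

(** Distance in levels to the farther end of the diametral path; by [ecc_weight] it is the
    eccentricity. *)
Definition weight v := if lev v <= r then d - lev v else lev v.

Definition low v := lev v <= r.

Lemma weight_bounds v : r < weight v <= d.
Proof. by rewrite /weight /d; have := lev_le L v; case: ifP; lia. Qed.

Lemma dist_cross u v : low u != low v -> dist G u v = weight u + weight v - d.
Proof.
have aux x y : low x -> ~~ low y -> dist G x y = weight x + weight y - d.
  rewrite /low /weight -ltnNge => hx hy; rewrite hx leqNgt hy /= /d.
  have := dist_le (walk_lo_hi hx hy); have := lev_dist x y; have := lev_le L y; lia.
case: (boolP (low u)); case: (boolP (low v)) => // hv hu _; first exact: aux.
by rewrite distC ?aux 1?addnC //; apply: leveling_connected.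
Qed.

(** The walk through the centre of the common half has length [weight u + weight v - d - 1]. *)
Lemma dist_same u v : low u = low v -> dist G u v + d < weight u + weight v.
Proof.
rewrite /low /weight /d.
have [lu lv] := (lev_le L u, lev_le L v).
have [hu|hu] := leqP (lev u) r; have [hv|hv] := leqP (lev v) r => // _.
  by have := dist_le (walk_lo_lo L hu hv); lia.
by have := dist_le (walk_hi_hi hu hv); lia.
Qed.

Lemma deep_exists b : exists2 v, low v = b & weight v = d.
Proof.
case: b; [have [v e] := lev_bot L|have [v e] := lev_top L]; exists v;
  by rewrite /low /weight e // /d; case: leqP; lia.
Qed.

Lemma ecc_weight v : ecc G v = weight v.
Proof.
apply/eqP; rewrite eqn_leq; apply/andP; split.
  apply/bigmax_leqP => u _; have := weight_bounds u.
  have [e|ne] := eqVneq (low v) (low u); first by have := dist_same e; lia.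
  by rewrite dist_cross //; lia.
have [u e1 e2] := deep_exists (~~ low v).
have := leq_dist_ecc G v u; rewrite dist_cross ?e1; last by case: low.
by rewrite e2; lia.
Qed.

(** Between opposite halves the distance [weight u + weight v - d] equals the smaller weight exactly
    when the larger one is [d]; inside a half it is strictly below the smaller weight. *)
Lemma ecc_entryE u v : dist G u v == minn (ecc G u) (ecc G v) =
  (low u != low v) && ((weight u == d) || (weight v == d)).
Proof.
rewrite !ecc_weight; have [wu wv] := (weight_bounds u, weight_bounds v).
have [e|ne] := eqVneq (low u) (low v) => /=.
  have := dist_same e; move: wu wv; rewrite /d; lia.
by rewrite dist_cross //; move: wu wv; rewrite /d; lia.
Qed.

End LevelMatrix.

Local Open Scope ring_scope.
Import Order.TTheory GRing.Theory Num.Theory.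

Section Eigen.
Variables (V : finType) (G : sgraph V) (R : realType).

Definition ecc_entry (u v : V) : R :=
  if dist G u v == minn (ecc G u) (ecc G v) then (dist G u v)%:R else 0.

Lemma ecc_eigenvalueP (a : R) :
  eigenvalue (ecc_matrix G R) a <->
  exists2 f : V -> R, (exists v, f v != 0) &
    forall v, \sum_u f u * ecc_entry u v = a * f v.
Proof.
have reind (F : V -> R) : \sum_u F u = \sum_(i < #|V|) F (enum_val i).
  exact: (reindex _ (onW_bij _ (@enum_val_bij V))).
split=> [/eigenvalueP[x xM x0]|[f [v fv] fM]].
  exists (fun v => x 0 (enum_rank v)).
    case/rV0Pn: x0 => i xi; exists (enum_val i).
    by rewrite enum_valK.
  move=> v; have /rowP/(_ (enum_rank v)) := xM; rewrite !mxE => <-.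
  rewrite reind; apply: eq_bigr => i _.
  by rewrite enum_valK !mxE enum_rankK.
apply/eigenvalueP; exists (\row_i f (enum_val i)).
  apply/rowP => j; rewrite !mxE -fM reind; apply: eq_bigr => i _.
  by rewrite !mxE.
by apply/rV0Pn; exists (enum_rank v); rewrite mxE enum_rankK.
Qed.

End Eigen.

(** * The largest eigenvalue *)

Section LargerRoot.
Variable R : realType.
Implicit Types al be ga l : R.

(** The relation satisfied by the squared eigenvalue [l], with [al], [be], [ga] standing for [p SB],
    [q SA], [d^2 p q]. *)
Definition quad al be ga l : R := (l - al) * (l - be) - ga * l.

Definition larger_root al be ga : R :=
  (al + be + ga + Num.sqrt ((al + be + ga) ^+ 2 - 4 * al * be)) / 2.

Variables al be ga : R.
Hypotheses (al0 : 0 < al) (be0 : 0 < be) (ga0 : 0 < ga).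

Let disc := (al + be + ga) ^+ 2 - 4 * al * be.

Lemma disc_gt0 : 0 < disc.
Proof.
rewrite /disc; have -> : (al + be + ga) ^+ 2 - 4 * al * be =
  (al - be) ^+ 2 + (2 * (al + be) + ga) * ga by ring.
by apply: ltr_wpDl; [exact: sqr_ge0 | rewrite mulr_gt0 ?addr_gt0 ?mulr_gt0 ?addr_gt0].
Qed.

Lemma quad_root : quad al be ga (larger_root al be ga) = 0.
Proof.
rewrite /larger_root -/disc; have := sqr_sqrtr (ltW disc_gt0).
set s := Num.sqrt disc => es.
suff : 4 * quad al be ga ((al + be + ga + s) / 2) = s ^+ 2 - disc.
  by rewrite es subrr => /eqP; rewrite mulf_eq0 => /orP[/eqP|/eqP //]; lra.
by rewrite /quad /disc; field.
Qed.

Lemma larger_root_center : (al + be + ga) / 2 < larger_root al be ga.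
Proof.
rewrite /larger_root -/disc; have : 0 < Num.sqrt disc by rewrite sqrtr_gt0 disc_gt0.
lra.
Qed.

(** By [larger_root_center] the larger root lies right of the vertex of the parabola, so [quad] is
    nonnegative from that root on. Comparing roots thus reduces to the sign of [quad] at one
    point. *)
Lemma quad_lt l : quad al be ga l < 0 -> l < larger_root al be ga.
Proof.
move=> ql; rewrite ltNge; apply/negP => h.
have := quad_root; have := larger_root_center; set L := larger_root _ _ _ in h *.
move: ql; rewrite /quad => ql hL q0.
have : 0 <= (l - L) * (l + L - (al + be + ga)) by apply: mulr_ge0; lra.
have -> : (l - L) * (l + L - (al + be + ga)) =
  (l - al) * (l - be) - ga * l - ((L - al) * (L - be) - ga * L) by ring.
lra.
Qed.

Lemma quad_le l : quad al be ga l = 0 -> l <= larger_root al be ga.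
Proof.
move=> ql; rewrite leNgt; apply/negP => h.
have := quad_root; have := larger_root_center; set L := larger_root _ _ _ in h *.
move: ql; rewrite /quad => ql hL q0.
have : 0 < (l - L) * (l + L - (al + be + ga)) by apply: mulr_gt0; lra.
have -> : (l - L) * (l + L - (al + be + ga)) =
  (l - al) * (l - be) - ga * l - ((L - al) * (L - be) - ga * L) by ring.
lra.
Qed.

Lemma larger_root_gtl : al < larger_root al be ga.
Proof.
apply: quad_lt; rewrite /quad subrr mul0r sub0r oppr_lt0; exact: mulr_gt0.
Qed.

Lemma larger_root_gtr : be < larger_root al be ga.
Proof.
apply: quad_lt; rewrite /quad subrr mulr0 sub0r oppr_lt0; exact: mulr_gt0.
Qed.

End LargerRoot.

Lemma larger_rootC (R : realType) (al be ga : R) :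
  larger_root al be ga = larger_root be al ga.
Proof. by rewrite /larger_root (addrC al be) -!mulrA (mulrC al be). Qed.

Section Spectrum.
Variables (V : finType) (G : sgraph V) (r : nat) (lev : V -> nat) (R : realType).
Hypothesis L : leveling G r lev.
Let d := r.*2.+1.
Let w := weight r lev.
Let lo := low r lev.

(** With [true] for the low half, the two values are [p] and [q], and those of [shallow] are [SA]
    and [SB]. *)
Definition ndeep (b : bool) : nat := #|[pred v | (lo v == b) && (w v == d)]|.

Definition shallow (b : bool) : nat :=
  (\sum_(v | (lo v == b) && (w v != d)) w v ^ 2)%N.

Lemma ndeep_gt0 b : (0 < ndeep b)%N.
Proof.
by have [v e1 e2] := deep_exists L b; apply/card_gt0P; exists v; rewrite inE /lo /w e1 e2 !eqxx.
Qed.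

Let X (f : V -> R) b := \sum_(v | (lo v == b) && (w v == d)) f v.
Let Z (f : V -> R) b := \sum_(v | (lo v == b) && (w v != d)) (w v)%:R * f v.

(** Between opposite halves, once one vertex is deepest the distance is the weight of the other.
    Column [v] thus sees [f] only through two sums over the opposite half. *)
Lemma ecc_columnE f v :
  \sum_u f u * ecc_entry G R u v =
  (w v)%:R * X f (~~ lo v) + (if w v == d then Z f (~~ lo v) else 0).
Proof.
have -> : (if w v == d then Z f (~~ lo v) else 0) =
  \sum_u (if [&& w v == d, lo u == ~~ lo v & w u != d] then (w u)%:R * f u else 0).
  case: ifP => _ /=; last by rewrite big1.
  by rewrite /Z big_mkcond.
rewrite [X f _]big_mkcond mulr_sumr -big_split /=; apply: eq_bigr => u _.
rewrite /ecc_entry (ecc_entryE L) -/w -/d -/lo.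
have -> : (lo u == ~~ lo v) = (lo u != lo v) by case: (lo u); case: (lo v).
have [e|ne] /= := eqVneq (lo u) (lo v); first by rewrite andbF !mulr0 addr0.
rewrite (dist_cross L) // -/w -/d.
have [eu|_] := eqVneq (w u) d; have [ev|_] := eqVneq (w v) d => /=;
  rewrite ?eu ?ev ?addnK 1?[(d + _)%N]addnC ?addnK; ring.
Qed.

Let al : R := (ndeep true * shallow false)%N%:R.
Let be : R := (ndeep false * shallow true)%N%:R.
Let ga : R := (d ^ 2 * ndeep true * ndeep false)%N%:R.

(** After multiplication by [a], the eigenvector equation at shallow vertices turns [Z] into a
    multiple of [X]; a 2 by 2 system for the two values of [X f] remains. *)
Lemma eigen_deep_sum f a : (forall v, \sum_u f u * ecc_entry G R u v = a * f v) ->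
  forall b, a ^+ 2 * X f b =
    (ndeep b)%:R * (d%:R * a * X f (~~ b) + (shallow (~~ b))%:R * X f b).
Proof.
move=> fM b.
have aZ : a * Z f (~~ b) = (shallow (~~ b))%:R * X f b.
  rewrite /Z /shallow natr_sum mulr_sumr mulr_suml; apply: eq_bigr => v /andP[/eqP vb /negPf vd].
  rewrite mulrCA -fM ecc_columnE vd addr0 vb negbK natrX; ring.
have aX : a * X f b = (ndeep b)%:R * (d%:R * X f (~~ b) + Z f (~~ b)).
  rewrite {1}/X mulr_sumr mulr_natl -sumr_const; apply: eq_bigr => v /andP[/eqP vb /eqP vd].
  by rewrite -fM ecc_columnE vd eqxx vb.
rewrite expr2 -mulrA aX -aZ; ring.
Qed.

(** The system of [eigen_deep_sum] has determinant [quad]. Were it nonzero, both deep sums would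
    vanish by Cramer's rule, then [f] on shallow vertices because [a != 0], then [Z f], and finally
    all of [f]. *)
Lemma eigen_quad a : eigenvalue (ecc_matrix G R) a -> a != 0 ->
  quad al be ga (a ^+ 2) = 0.
Proof.
move=> /ecc_eigenvalueP[f [v0 fv0] fM] a0; have E := eigen_deep_sum fM.
have e1 := E true; have e2 := E false; rewrite /= in e1 e2.
rewrite /quad /al /be /ga !natrM.
set x := X f true in e1 e2 *; set y := X f false in e1 e2 *.
move: e1 e2; set p := (ndeep true)%:R; set q := (ndeep false)%:R.
set s := (shallow false)%:R; set t := (shallow true)%:R; set dd := d%:R => e1 e2.
set Q := _ - _.
have Qx : Q * x = 0.
  have -> : Q * x = (a ^+ 2 - q * t) * (a ^+ 2 * x - p * (dd * a * y + s * x))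
     + p * dd * a * (a ^+ 2 * y - q * (dd * a * x + t * y)) by rewrite /Q; ring.
  by rewrite e1 e2 !subrr !mulr0 addr0.
have Qy : Q * y = 0.
  have -> : Q * y = (a ^+ 2 - p * s) * (a ^+ 2 * y - q * (dd * a * x + t * y))
     + q * dd * a * (a ^+ 2 * x - p * (dd * a * y + s * x)) by rewrite /Q; ring.
  by rewrite e1 e2 !subrr !mulr0 addr0.
have [//|Q0] := eqVneq Q 0.
have x0 : x = 0 by apply/eqP; move/eqP: Qx; rewrite mulf_eq0 (negPf Q0).
have y0 : y = 0 by apply/eqP; move/eqP: Qy; rewrite mulf_eq0 (negPf Q0).
have X0 b : X f b = 0 by case: b.
have sh v : w v != d -> f v = 0.
  move=> vd; have := fM v; rewrite ecc_columnE (negPf vd) X0 mulr0 addr0 => /esym/eqP.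
  by rewrite mulf_eq0 (negPf a0) => /eqP.
have Z0 b : Z f b = 0 by apply: big1 => v /andP[_ /sh ->]; rewrite mulr0.
move/eqP: fv0; case; apply/eqP; have := fM v0.
rewrite ecc_columnE X0 Z0 mulr0 add0r if_same => /esym/eqP.
by rewrite mulf_eq0 (negPf a0).
Qed.

Lemma quad_eigen a : 0 < a -> al < a ^+ 2 -> quad al be ga (a ^+ 2) = 0 ->
  eigenvalue (ecc_matrix G R) a.
Proof.
move=> a0 ala q0; apply/ecc_eigenvalueP.
have p0 : (ndeep true)%:R != 0 :> R by rewrite pnatr_eq0 -lt0n ndeep_gt0.
have q0' : (ndeep false)%:R != 0 :> R by rewrite pnatr_eq0 -lt0n ndeep_gt0.
have a0' : a != 0 by rewrite gt_eqF.
(* [(x, y)] solves the first equation of the system. The vector [f] is constant on the deepest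
   vertices of each half, with total [x] or [y]; on shallow ones its values are dictated by the
   eigenvector equation. *)
pose x : R := (ndeep true)%:R * d%:R * a; pose y : R := a ^+ 2 - al.
pose f v : R := if lo v then if w v == d then x / (ndeep true)%:R else (w v)%:R * y / a
                else if w v == d then y / (ndeep false)%:R else (w v)%:R * x / a.
have Xt : X f true = x.
  rewrite /X (eq_bigr (fun=> x / (ndeep true)%:R)) => [|v /andP[/eqP vb vd]];
    last by rewrite /f vb vd.
  rewrite sumr_const -mulr_natr -[#|_|]/(ndeep true); by field.
have Xf : X f false = y.
  rewrite /X (eq_bigr (fun=> y / (ndeep false)%:R)) => [|v /andP[/eqP vb vd]];
    last by rewrite /f vb vd.
  rewrite sumr_const -mulr_natr -[#|_|]/(ndeep false); by field.
have Zt : Z f true = (shallow true)%:R * y / a.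
  rewrite /Z /shallow natr_sum !mulr_suml; apply: eq_bigr => v /andP[/eqP vb /negPf vd].
  by rewrite /f vb vd natrX; field.
have Zf : Z f false = (shallow false)%:R * x / a.
  rewrite /Z /shallow natr_sum !mulr_suml; apply: eq_bigr => v /andP[/eqP vb /negPf vd].
  by rewrite /f vb vd natrX; field.
exists f.
  have [v e1 e2] := deep_exists L true; exists v.
  rewrite /f /lo /w e1 e2 eqxx /x -!mulrA mulrC !mulf_eq0 invr_eq0 pnatr_eq0.
  by rewrite (negPf p0) (negPf a0').
move=> v; rewrite ecc_columnE /f; case: (lo v) => /=; case: (eqVneq (w v) d) => [->|_].
- by rewrite Xf Zf /x /y /al natrM; field; rewrite p0 a0'.
- by rewrite Xf; field.
- rewrite Xt Zt.
  (* The second equation of the system amounts to the vanishing of [quad]. *)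
  have Y : a ^+ 2 * y = (ndeep false)%:R * (d%:R * a * x + (shallow true)%:R * y).
    apply/eqP; rewrite -subr_eq0 -q0; apply/eqP.
    by rewrite /quad /be /ga /x /y !natrM; ring.
  transitivity (a ^+ 2 * y / (a * (ndeep false)%:R)); last by field; rewrite q0' a0'.
  by rewrite Y; field; rewrite q0' a0'.
- by rewrite Xt; field.
Qed.

Hypothesis sh0 : forall b, (0 < shallow b)%N.

(** Nonzero eigenvalues square to roots of [quad], so the square root of the larger root is an upper
    bound, and [quad_eigen] attains it. *)
Lemma ecc_spectral_maxE : ecc_spectral_max G R = Num.sqrt (larger_root al be ga).
Proof.
have al0 : 0 < al by rewrite ltr0n muln_gt0 ndeep_gt0 sh0.
have be0 : 0 < be by rewrite ltr0n muln_gt0 ndeep_gt0 sh0.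
have ga0 : 0 < ga by rewrite ltr0n !muln_gt0 !ndeep_gt0.
have gl := larger_root_gtl al0 be0 ga0.
set la := larger_root al be ga in gl *.
have la0 : 0 < la := lt_trans al0 gl.
have sq : Num.sqrt la ^+ 2 = la by rewrite sqr_sqrtr // ltW.
have ub : ubound [set x : R | eigenvalue (ecc_matrix G R) x]%classic (Num.sqrt la).
  move=> a /= ea; have [->|a0] := eqVneq a 0; first exact: sqrtr_ge0.
  apply: le_trans (ler_norm a) _; rewrite -sqrtr_sqr ler_sqrt ?(ltW la0) //.
  exact: quad_le (eigen_quad ea a0).
have ex : eigenvalue (ecc_matrix G R) (Num.sqrt la).
  by apply: quad_eigen; rewrite ?sq ?sqrtr_gt0 //; apply: quad_root.
apply/eqP; rewrite eq_le; apply/andP; split.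
  by apply: (ge_sup _ ub); exists (Num.sqrt la).
by apply: (ub_le_sup _ ex); exists (Num.sqrt la).
Qed.

End Spectrum.

(** * Comparison of profiles *)

Section Comparison.
Variable R : realType.

(* [p], [q], [SA], [SB] are as in the header, [D] stands for [d^2]. *)
Definition profile_root (D p q SA SB : nat) : R :=
  larger_root (p * SB)%N%:R (q * SA)%N%:R (D * p * q)%N%:R.

Lemma profile_rootC D p q SA SB : profile_root D p q SA SB = profile_root D q p SB SA.
Proof. by rewrite /profile_root larger_rootC mulnAC. Qed.

Lemma profile_root_gt0 D p q SA SB : (0 < D)%N -> (0 < p)%N -> (0 < q)%N ->
  (0 < SA)%N -> (0 < SB)%N -> 0 < profile_root D p q SA SB.
Proof.
move=> D0 p0 q0 A0 B0; apply: lt_trans (larger_root_gtl _ _ _);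
  by rewrite ltr0n !muln_gt0 ?D0 ?p0 ?q0 ?A0 ?B0.
Qed.

(** Here [x] shallow vertices, with squared eccentricities totalling [SA - S], become deepest. By
    [quad_lt] it suffices that the new quadratic is negative at the old root. *)
Lemma profile_root_deepen D p q x S SA SB :
  (0 < D)%N -> (0 < p)%N -> (0 < q)%N -> (0 < S)%N -> (0 < SB)%N -> (0 < x)%N ->
  (S <= SA)%N -> (SA <= S + D * x)%N ->
  profile_root D p q SA SB < profile_root D (p + x) q S SB.
Proof.
move=> D0 p0 q0 S0 B0 x0 SSA SAx; have A0 : (0 < SA)%N by lia.
have al0 : 0 < (p * SB)%N%:R :> R by rewrite ltr0n muln_gt0 p0.
have be0 : 0 < (q * SA)%N%:R :> R by rewrite ltr0n muln_gt0 q0.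
have ga0 : 0 < (D * p * q)%N%:R :> R by rewrite ltr0n !muln_gt0 D0 p0.
have gr := larger_root_gtr al0 be0 ga0; have root := quad_root al0 be0 ga0.
rewrite /profile_root; set l := larger_root _ _ _ in gr root *.
have l0 : 0 < l := lt_trans be0 gr.
apply: quad_lt; rewrite ?ltr0n ?muln_gt0 ?addn_gt0 ?D0 ?p0 ?q0 ?S0 ?B0 //.
pose e := (SA - S)%N; have eA : SA = (S + e)%N by rewrite /e; lia.
have ex : (e <= D * x)%N by lia.
pose g := (D * x - e)%N; have eg : (D%:R * x%:R = e%:R + g%:R :> R).
  by rewrite -natrM -natrD; congr (_%:R); rewrite /g; lia.
have q0R : 0 < q%:R :> R by rewrite ltr0n.
have B0R : 0 < SB%:R :> R by rewrite ltr0n.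
have x0R : 0 < x%:R :> R by rewrite ltr0n.
rewrite -[ltRHS]root /quad eA !natrM !natrD -subr_gt0.
set X := (X in 0 < X).
(* The drop of the quadratic is a sum of nonnegative terms, the first positive because the old root
   exceeds [q SA >= q S]. *)
have -> : X = x%:R * SB%:R * (l - (q * S)%N%:R) + l * q%:R * g%:R + SB%:R * q%:R * p%:R * e%:R.
  have -> : g%:R = D%:R * x%:R - e%:R :> R by rewrite eg; ring.
  by rewrite /X natrM; ring.
have hl : 0 < l - (q * S)%N%:R.
  by rewrite subr_gt0; apply: le_lt_trans gr; rewrite ler_nat leq_mul2l SSA orbT.
rewrite -addrA ltr_pwDl //; first by rewrite !mulr_gt0.
have l0' := ltW l0; have n0 (k : nat) : 0 <= k%:R :> R by rewrite ler0n.
exact: addr_ge0 (mulr_ge0 (mulr_ge0 l0' _) _) (mulr_ge0 (mulr_ge0 (mulr_ge0 _ _) _) _).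
Qed.

(** As [p + q] is fixed, the two quadratics differ at [l] by [(p' q' - p q) (D l - S^2)], so the
    sign of [D l - S^2] at the old root decides. *)
Lemma profile_root_balance D S p q p' q' :
  (0 < D)%N -> (0 < S)%N -> (0 < p)%N -> (0 < q)%N -> (0 < p')%N -> (0 < q')%N ->
  (p + q = p' + q')%N ->
  (S < (p + q) * D /\ p * q < p' * q')%N \/ ((p + q) * D < S /\ p' * q' < p * q)%N ->
  profile_root D p q S S < profile_root D p' q' S S.
Proof.
move=> D0 S0 p0 q0 p0' q0' es h.
have al0 : 0 < (p * S)%N%:R :> R by rewrite ltr0n muln_gt0 p0.
have be0 : 0 < (q * S)%N%:R :> R by rewrite ltr0n muln_gt0 q0.
have ga0 : 0 < (D * p * q)%N%:R :> R by rewrite ltr0n !muln_gt0 D0 p0.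
have gr := larger_root_gtr al0 be0 ga0; have root := quad_root al0 be0 ga0.
have below := quad_lt al0 be0 ga0.
rewrite /profile_root; set l := larger_root _ _ _ in gr root below *.
have l0 : 0 < l := lt_trans be0 gr.
apply: quad_lt; rewrite ?ltr0n ?muln_gt0 ?addn_gt0 ?D0 ?p0' ?q0' ?S0 //.
have es' : p%:R + q%:R = p'%:R + q'%:R :> R by rewrite -!natrD es.
rewrite -[ltRHS]root -subr_gt0.
have -> : quad (p * S)%:R (q * S)%:R (D * p * q)%:R l -
   quad (p' * S)%:R (q' * S)%:R (D * p' * q')%:R l =
   ((p' * q')%N%:R - (p * q)%N%:R) * (D%:R * l - S%:R ^+ 2).
  rewrite /quad !natrM.
  have -> : p%:R = p'%:R + q'%:R - q%:R :> R by rewrite -es'; ring.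
  ring.
have D0R : 0 < D%:R :> R by rewrite ltr0n.
have S0R : 0 < S%:R :> R by rewrite ltr0n.
have DN : D%:R != 0 :> R by rewrite gt_eqF.
case: h => -[hS ht].
  apply: mulr_gt0; first by rewrite subr_gt0 ltr_nat.
  (* Here [S^2 / D] lies below the root: the quadratic there is [S^3 / D^2 (S - (p + q) D) < 0]. *)
  rewrite subr_gt0 mulrC -ltr_pdivrMr //; apply: below.
  have -> : quad (p * S)%:R (q * S)%:R (D * p * q)%:R (S%:R ^+ 2 / D%:R) =
     S%:R ^+ 3 / D%:R ^+ 2 * (S%:R - ((p + q) * D)%N%:R) :> R.
    by rewrite /quad !natrM natrD; field.
  by rewrite pmulr_rlt0 ?subr_lt0 ?ltr_nat // divr_gt0 // exprn_gt0.
rewrite -mulrNN; apply: mulr_gt0; first by rewrite opprB subr_gt0 ltr_nat.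
rewrite opprB subr_gt0 ltNge; apply/negP => hl.
(* With [s = p + q] and [t = p q]: [l (l - s S) = t (D l - S^2) <= t D (l - s S)] because
   [s D < S], hence [l <= t D <= s^2 D < s S < l]. *)
move: root; rewrite /quad !natrM => root.
have hS' : (p%:R + q%:R) * D%:R < S%:R :> R by rewrite -natrD -natrM ltr_nat.
have p0R : 0 < p%:R :> R by rewrite ltr0n.
have q0R : 0 < q%:R :> R by rewrite ltr0n.
set P := p%:R in root hS' p0R *; set Q := q%:R in root hS' q0R *.
set DD := D%:R in root hS' hl D0R *; set SS := S%:R in root hS' hl S0R *.
have lS : (P + Q) * SS < l.
  rewrite -(ltr_pM2l D0R); apply: lt_le_trans hl.
  by rewrite mulrA (mulrC DD) expr2 ltr_pM2r.
have e1 : l * (l - (P + Q) * SS) = P * Q * (DD * l - SS ^+ 2).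
  by apply/eqP; rewrite -subr_eq0 -root; apply/eqP; ring.
have e2 : DD * l - SS ^+ 2 <= DD * (l - (P + Q) * SS).
  have : DD * ((P + Q) * SS) <= SS ^+ 2 by rewrite mulrA expr2 ler_pM2r // mulrC ltW.
  by rewrite mulrBr => h; rewrite lerD2l lerN2.
have e3 : l * (l - (P + Q) * SS) <= P * Q * DD * (l - (P + Q) * SS).
  by rewrite e1 -!mulrA ler_pM2l // ler_pM2l // .
move: e3; rewrite ler_pM2r ?subr_gt0 // => e3.
have e4 : P * Q * DD <= (P + Q) * ((P + Q) * DD).
  rewrite mulrA ler_pM2r // mulrDl !mulrDr.
  by have := mulr_gt0 p0R q0R; have := mulr_gt0 p0R p0R; have := mulr_gt0 q0R q0R;
     rewrite (mulrC Q P); lra.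
have e5 : (P + Q) * ((P + Q) * DD) < (P + Q) * SS by rewrite ltr_pM2l // addr_gt0.
by move: (le_lt_trans (le_trans e3 e4) (lt_trans e5 lS)); rewrite ltxx.
Qed.

End Comparison.

(* Sums of squared eccentricities on a bare path *)
Local Close Scope ring_scope.

(* The common value of [SA] and [SB] for double brooms. *)
Definition half_squares (r : nat) : nat := \sum_(k < r.*2.+1 | r < k) k ^ 2.

Lemma sum_squares n : 6 * (\sum_(k < n.+1) k ^ 2) = n * n.+1 * n.*2.+1.
Proof.
elim: n => [|n IH]; first by rewrite big_ord_recl big_ord0.
by rewrite big_ord_recr /= mulnDr IH; lia.
Qed.

Lemma half_squaresE r : 6 * half_squares r = r * r.*2.+1 * (7 * r).+1.
Proof.
have := sum_squares r.*2; have := sum_squares r.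
rewrite (bigID (fun k : 'I_r.*2.+1 => r < k)) /= -/(half_squares r).
have -> : \sum_(i < r.*2.+1 | ~~ (r < i)) i ^ 2 = \sum_(k < r.+1) k ^ 2.
  rewrite (big_ord_widen r.*2.+1 (fun k => k ^ 2)); last by lia.
  by apply: eq_bigl => i; rewrite -leqNgt ltnS.
by rewrite mulnDr => -> ; lia.
Qed.

Lemma card_half r : \sum_(k < r.*2.+1 | r < k) 1 = r.
Proof.
have S1 n : \sum_(k < n) 1 = n by rewrite sum_nat_const card_ord muln1.
have := S1 r.*2.+1.
rewrite (bigID (fun k : 'I_r.*2.+1 => r < k)) /=.
have -> : \sum_(i < r.*2.+1 | ~~ (r < i)) 1 = \sum_(k < r.+1) 1.
  rewrite (big_ord_widen r.*2.+1 (fun k => 1)); last by lia.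
  by apply: eq_bigl => i; rewrite -leqNgt ltnS.
by rewrite S1; lia.
Qed.

(* [6 S / d^2 = r (7r + 1) / d] and [4 r (7r + 1) = 5] modulo [d = 2r + 1], so equality would
   force [d] to divide [5]. *)
Lemma half_squares_neq r s : 1 < r -> 1 < s -> s * r.*2.+1 ^ 2 <> half_squares r.
Proof.
move=> r1 s1 e; have := half_squaresE r; rewrite -e => h.
have {}h : 6 * s * r.*2.+1 = r * (7 * r).+1.
  have : (6 * s * r.*2.+1) * r.*2.+1 = (r * (7 * r).+1) * r.*2.+1 by lia.
  by move/eqP; rewrite eqn_pmul2r // => /eqP.
have d5 : r.*2.+1 %| 5.
  (* Four times [h], with [4 r (7r + 1) = d (14 r - 5) + 5], arranged without subtraction. *)
  have e5 : r.*2.+1 * (24 * s) + r.*2.+1 * 5 = r.*2.+1 * (14 * r) + 5 by lia.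
  rewrite -(dvdn_addr (m := r.*2.+1 * (14 * r))) ?dvdn_mulr //.
  by rewrite -e5 dvdn_add ?dvdn_mulr.
(* For [r = 2] the equation reads [30 s = 30], contrary to [s > 1]. *)
have r2 : r = 2 by have := dvdn_leq (ltn0Sn 4) d5; lia.
by move: h; rewrite r2; lia.
Qed.

(** * Level counts *)

Section Profile.
Variables (V : finType) (G : sgraph V) (r : nat) (lev : V -> nat).
Hypothesis L : leveling G r lev.
Let d := r.*2.+1.
Let w := weight r lev.
Let lo := low r lev.

(* Below the maximal weight, half [b] is a bare path. *)
Definition thin_side (b : bool) : Prop :=
  forall u v, lo u = b -> lo v = b -> w u = w v -> w u != d -> u = v.

Lemma level_inhabited b k : r < k < d -> exists v, (lo v == b) && (w v == k).
Proof.
move=> hk; case: b.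
  have [u eu] := lev_bot L.
  have [|c ec _] := @walk_to_level _ _ _ _ L (d - k) u; first by rewrite eu /d in hk *; lia.
  by exists c; rewrite /lo /w /low /weight ec -/d in hk *; case: leqP; rewrite /d in hk *; lia.
have [u eu] := lev_top L; have L' := leveling_rev L.
have [|c ec _] := @walk_to_level _ _ _ _ L' (d - k) u; first by rewrite eu /d in hk *; lia.
have ck : lev c = k by rewrite /d in hk ec; lia.
by exists c; rewrite /lo /w /low /weight ck; case: leqP; lia.
Qed.

Let M b k := #|[pred v | (lo v == b) && (w v == k)]|.

Lemma sum_by_weight b (F : nat -> nat) :
  \sum_(v | (lo v == b) && (w v != d)) F (w v) = \sum_(k < d | r < k) M b k * F k.
Proof.
have wb v : r < w v <= d := weight_bounds L v.
rewrite (partition_big (fun v => inord (w v) : 'I_d) (fun k => r < k)) /=; last first.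
  by move=> v /andP[_ vd]; rewrite inordK; have := wb v; move: vd; rewrite /d; lia.
apply: eq_bigr => k rk; rewrite -sum_nat_const.
apply: congr_big => // [v|v /andP[/andP[_ vd] /eqP <-]].
  rewrite !inE -andbA; congr (_ && _); rewrite -val_eqE /=.
  have kd := ltn_ord k; have := wb v.
  have [e|ne] := eqVneq (w v) d; first by rewrite e (gtn_eqF kd).
  by move=> h /=; rewrite inordK //; move: ne h; rewrite /d; lia.
by rewrite inordK //; have := wb v; move: vd; rewrite /d; lia.
Qed.

(** [x] counts the vertices beyond the first at each weight strictly between [r] and [d]. Every such
    weight occurs, which gives [half_squares]; each further vertex adds at most [d^2]. *)
Lemma shallow_bounds b : exists x,
  [/\ \sum_(v | (lo v == b) && (w v != d)) 1 = r + x,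
      half_squares r <= shallow r lev b,
      shallow r lev b <= half_squares r + d ^ 2 * x & x = 0 <-> thin_side b].
Proof.
have M0 (k : 'I_d) : r < k -> 0 < M b k.
  move=> rk; have [|v hv] := @level_inhabited b k; first by rewrite rk ltn_ord.
  by apply/card_gt0P; exists v; rewrite inE.
exists (\sum_(k < d | r < k) (M b k - 1)).
rewrite /shallow (sum_by_weight b (fun k => k ^ 2)) (sum_by_weight b (fun=> 1)).
split.
- rewrite -{2}(card_half r) -big_split /=; apply: eq_bigr => k rk.
  by have := M0 k rk; lia.
- by apply: leq_sum => k rk; rewrite -{1}(mul1n (k ^ 2)) leq_mul2r M0 ?orbT.
- rewrite big_distrr -big_split /=; apply: leq_sum => k rk.
  have h : k ^ 2 * (M b k - 1) <= d ^ 2 * (M b k - 1).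
    by rewrite leq_mul2r leq_exp2r // ltnW ?orbT.
  apply: leq_trans (leq_add (leqnn _) h).
  by rewrite -mulnS mulnC leq_mul2l; have := M0 k rk; lia.
- have wb v : r < w v <= d := weight_bounds L v.
  split=> [/eqP|th].
    rewrite sum_nat_eq0 => /forallP all0 u v ub vb uv ud.
    have ltd : w u < d by rewrite ltn_neqAle ud; case/andP: (wb u).
    have /implyP := all0 (Ordinal ltd); rewrite /= => /(_ _)/eqP.
    have ru : r < w u by case/andP: (wb u).
    move=> /(_ ru) /eqP; rewrite subn_eq0 => /card_le1_eqP; apply; rewrite inE.
      by rewrite vb -uv !eqxx.
    by rewrite ub !eqxx.
  apply/eqP; rewrite sum_nat_eq0; apply/forallP => k; apply/implyP => rk.
  rewrite subn_eq0; apply/card_le1_eqP => u v.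
  rewrite !inE => /andP[/eqP ub /eqP uk] /andP[/eqP vb /eqP vk].
  by apply: th; rewrite ?ub ?vb ?uk ?vk // neq_ltn ltn_ord.
Qed.

Lemma card_profile : #|V| = ndeep r lev true + ndeep r lev false +
  \sum_(v | (lo v == true) && (w v != d)) 1 + \sum_(v | (lo v == false) && (w v != d)) 1.
Proof.
rewrite -sum1_card (bigID (fun v => lo v == true)) /=.
rewrite (bigID (fun v => w v == d)) /=.
rewrite [X in _ + X](bigID (fun v => w v == d)) /=.
rewrite /ndeep -!sum1_card.
have sw : forall P, \sum_(i | (lo i != true) && P i) 1 = \sum_(i | (lo i == false) && P i) 1.
  by move=> P; apply: eq_bigl => i; case: (lo i).
by rewrite !sw addnACA addnA.
Qed.

End Profile.

(** * Exchange of the two halves *)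

Section Reverse.
Variables (V : finType) (G : sgraph V) (r : nat) (lev : V -> nat).
Hypothesis L : leveling G r lev.
Let rev v := r.*2.+1 - lev v.

Lemma low_rev v : low r rev v = ~~ low r lev v.
Proof. by rewrite /low /rev; have := lev_le L v; lia. Qed.

Lemma weight_rev v : weight r rev v = weight r lev v.
Proof. by rewrite /weight /rev; have := lev_le L v; case: ifP; case: ifP; lia. Qed.

Lemma ndeep_rev b : ndeep r rev b = ndeep r lev (~~ b).
Proof.
apply: eq_card => v; rewrite !inE low_rev weight_rev.
by case: low; case: b.
Qed.

Lemma thin_side_rev b : thin_side r lev (~~ b) -> thin_side r rev b.
Proof.
move=> th u v; rewrite !low_rev !weight_rev => ub vb; apply: th.
  by rewrite -ub negbK.
by rewrite -vb negbK.
Qed.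

End Reverse.

(** The i-th element of each fibre of [f] goes to the i-th element of the same fibre of [g]. *)
Lemma bijection_of_fibers (V W : finType) (f : V -> nat) (g : W -> nat) :
  (forall k, #|[pred v | f v == k]| = #|[pred x | g x == k]|) ->
  exists2 h : V -> W, bijective h & forall v, g (h v) = f v.
Proof.
move=> fg.
have ex v : exists x, g x = f v.
  have : 0 < #|[pred x | g x == f v]|.
    by rewrite -fg; apply/card_gt0P; exists v; rewrite inE.
  by move=> /card_gt0P[x]; rewrite inE => /eqP; exists x.
have [x0 hx0] := choice ex.
pose ev k := enum [pred v | f v == k]; pose ew k := enum [pred x | g x == k].
have sz k : size (ev k) = size (ew k) by rewrite -!cardE fg.
pose h v := nth (x0 v) (ew (f v)) (index v (ev (f v))).
have iv v : index v (ev (f v)) < size (ew (f v)).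
  by rewrite -sz index_mem mem_enum inE.
have gh v : g (h v) = f v.
  by have := mem_nth (x0 v) (iv v); rewrite mem_enum inE => /eqP.
exists h => //; apply: inj_card_bij => [u v e|].
  have fuv : f u = f v by rewrite -!gh e.
  have : index u (ev (f v)) = index v (ev (f v)).
    apply/eqP; rewrite -(nth_uniq (x0 v) (s := ew (f v))) ?enum_uniq //; last first.
      by rewrite -fuv.
    apply/eqP; rewrite -[RHS]e /h fuv; apply: set_nth_default.
    by rewrite -fuv.
  have mu : u \in ev (f v) by rewrite mem_enum inE fuv.
  have mv : v \in ev (f v) by rewrite mem_enum inE.
  by move=> ei; rewrite -(nth_index u mu) ei nth_index.
have lim (U : finType) (F : U -> nat) n : (forall k, n <= k -> #|[pred u | F u == k]| = 0) ->
    #|U| = \sum_(k < n) #|[pred u | F u == k]|.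
  move=> h0.
  have Fn u : F u < n.
    rewrite ltnNge; apply/negP => /h0/card0_eq/(_ u); by rewrite !inE eqxx.
  rewrite -sum1_card (partition_big (fun u => Ordinal (Fn u)) predT) //=.
  by apply: eq_bigr => k _; rewrite -sum1_card; apply: eq_bigl => u; rewrite !inE.
pose n := (\max_v f v).+1.
have hn k : n <= k -> #|[pred v | f v == k]| = 0.
  move=> nk; apply: eq_card0 => v; rewrite !inE; apply/negP => /eqP e.
  by have := leq_bigmax (F := f) v; move: nk; rewrite /n -e; lia.
rewrite (lim V f n hn) (lim W g n); last by move=> k /hn; rewrite fg.
by apply: leq_sum => k _; rewrite fg.
Qed.

(** * Double brooms *)

Section ThinIso.
Variable r : nat.

(** Each level other than the two extreme ones holds at most one vertex, so the neighbour supplied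
    by [lev_up] or [lev_down] is the only candidate. *)
Lemma thin_adj (V : finType) (G : sgraph V) lev : leveling G r lev ->
  (forall b, thin_side r lev b) ->
  forall u v, adj G u v = (lev v == (lev u).+1) || (lev u == (lev v).+1).
Proof.
move=> L th.
have one u v : lev u = lev v -> 0 < lev u < r.*2.+1 -> u = v.
  move=> e h; apply: (th (low r lev v) u v); rewrite /low /weight ?e //.
  by move: h; rewrite e; case: ifP; lia.
have step u v : lev v = (lev u).+1 -> adj G u v.
  move=> e; have [h|h] := leqP (lev u) r.
    have [z uz ez] := lev_up L h; suff <- : z = v by [].
    have [e'|h'] := leqP (lev z) r; first by apply: one; lia.
    by apply: (lev_center L); lia.
  have [|z vz ez] := lev_down L (v := v); first by lia.
  rewrite adj_sym; suff <- : z = u by [].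
  by have lv := lev_le L v; apply: one; lia.
move=> u v; apply/idP/idP => [/(lev_adj L)[->|->]|/orP[]/eqP].
- by rewrite eqxx.
- by rewrite eqxx orbT.
- exact: step.
- by rewrite adj_sym; apply: step.
Qed.

Lemma card_level (V : finType) (G : sgraph V) lev : leveling G r lev ->
  (forall b, thin_side r lev b) -> forall k,
  #|[pred v | lev v == k]| = if k == 0 then ndeep r lev true
    else if k == r.*2.+1 then ndeep r lev false else k < r.*2.+1.
Proof.
move=> L th k; have le := lev_le L.
have [->|k0] := eqVneq k 0.
  by apply: eq_card => v; rewrite !inE /low /weight; have := le v;
    case: (leqP (lev v) r) => /=; lia.
have [->|kd] := eqVneq k r.*2.+1.
  by apply: eq_card => v; rewrite !inE /low /weight; have := le v;
    case: (leqP (lev v) r) => /=; lia.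
have [hk|hk] := ltnP k r.*2.+1; last first.
  by apply: eq_card0 => v; rewrite !inE; have := le v; lia.
pose b := k <= r; pose j := if b then r.*2.+1 - k else k.
have [|v /andP[/eqP vb /eqP vj]] := @level_inhabited V G r lev L b j.
  by rewrite /j /b; case: (leqP k r); lia.
have vk : lev v = k.
  by move: vb vj; rewrite /j /b /low /weight; have := le v;
    case: (leqP (lev v) r); case: (leqP k r); lia.
apply: (@eq_card1 _ v) => u; rewrite !inE; apply/eqP/eqP => [uk|-> //].
apply: (th b); rewrite /low /weight ?vk ?uk //.
by rewrite -/b; move: hk k0; rewrite /b; case: (leqP k r); lia.
Qed.

Lemma thin_isomorphic (V W : finType) (G : sgraph V) (H : sgraph W) lev lev' :
  leveling G r lev -> leveling H r lev' ->
  (forall b, thin_side r lev b) -> (forall b, thin_side r lev' b) ->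
  (forall b, ndeep r lev b = ndeep r lev' b) -> isomorphic G H.
Proof.
move=> L L' th th' nd; have [|h bh gh] := @bijection_of_fibers V W lev lev'.
  by move=> k; rewrite (card_level L th) (card_level L' th') !nd.
by exists h => // x y; rewrite (thin_adj L th) (thin_adj L' th') !gh.
Qed.

End ThinIso.

Section Broom.
Variables r a b : nat.
Hypothesis r0 : 0 < r.
Let d := r.*2.+1.

Definition D_level (x : D_vertex d a b) : nat :=
  match x with inl (inl i) => i | inl (inr _) => 0 | inr _ => d end.

Lemma D_leveling : leveling (D d a b) r D_level.
Proof.
have arc u v : D_arc u v -> D_level v = (D_level u).+1 \/ D_level u = (D_level v).+1.
  by case: u => [[i|i]|i]; case: v => [[j|j]|j] //= /eqP; have dE : d = r.*2.+1 by []; lia.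
have adjI u v : D_arc u v || D_arc v u -> adj (D d a b) u v by [].
have dE : d = r.*2.+1 by [].
split.
- by case=> [[i|i]|i] //=; rewrite -ltnS.
- by move=> u v /orP[] /arc //; case; [right|left].
- case=> [[i|i]|i] /= h.
  + have hi : i.+1 < d.+1 by lia.
    by exists (inl (inl (Ordinal hi))) => //; apply: adjI; rewrite /= eqxx.
  + have hi : 1 < d.+1 by lia.
    by exists (inl (inl (Ordinal hi))) => //; apply: adjI; rewrite /= orbT.
  + by lia.
- case=> [[i|i]|i] //= h.
  + have hi : i.-1 < d.+1 by have := ltn_ord i; lia.
    exists (inl (inl (Ordinal hi))) => /=; last by lia.
    by apply: adjI; rewrite /= prednK ?eqxx ?orbT //; lia.
  + have hi : d.-1 < d.+1 by lia.
    by exists (inl (inl (Ordinal hi))); [rewrite /D_adj /= eqxx | rewrite /=; lia].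
- case=> [[i|i]|i]; case=> [[j|j]|j] //=; try lia.
  by move=> e _; congr (inl (inl _)); apply: val_inj.
- by exists (inl (inl ord0)).
- by exists (inl (inl ord_max)).
Qed.

Lemma D_thin s : thin_side r D_level s.
Proof.
move=> u v; rewrite /low /weight => us vs; rewrite us vs.
have dE : d = r.*2.+1 by [].
by case: u us => [[i|i]|i]; case: v vs => [[j|j]|j] /=; case: s => //= h1 h2 e ne;
   try lia; congr (inl (inl _)); apply: val_inj => /=; have := ltn_ord i;
   have := ltn_ord j; lia.
Qed.

Lemma D_ndeep s : ndeep r D_level s = if s then a.+1 else b.+1.
Proof.
rewrite /ndeep -sum1_card big_sumType big_sumType /=.
rewrite (eq_bigl (pred1 (if s then ord0 else ord_max))) ?big_pred1_eq; last first.
  move=> i; rewrite !inE /low /weight -val_eqE /= -/d; have := ltn_ord i.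
  by have dE : d = r.*2.+1 by []; case: s; case: (leqP i r) => /=; lia.
rewrite (eq_bigl (fun=> s)); last first.
  by move=> i; rewrite !inE /low /weight /= subn0 eqxx andbT; case: s.
rewrite [X in _ + X](eq_bigl (fun=> ~~ s)); last first.
  move=> i; rewrite !inE /low /weight /=.
  by rewrite (_ : d <= r = false) ?eqxx ?andbT; [case: s | rewrite /d; lia].
by case: s => /=; rewrite big_pred0_eq sum_nat_const card_ord muln1 ?addn0 add1n.
Qed.

End Broom.

(** [p q] exceeds [m + 1] by [(p - 1) (q - 1)] and falls short of the balanced product by at least
    the square of the gap between the smaller part and [m./2 + 1]; so both equality cases are
    rigid. *)
Lemma product_bounds p q m : 0 < p -> 0 < q -> p + q = m.+2 ->
  [/\ m.+1 <= p * q <= (m./2).+1 * (uphalf m).+1,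
      p * q = m.+1 -> p = 1 \/ q = 1 &
      p * q = (m./2).+1 * (uphalf m).+1 -> p = (m./2).+1 \/ q = (m./2).+1].
Proof.
have [u hu] : exists u, u = uphalf m by exists (uphalf m).
have [h hh] : exists h, h = m./2 by exists m./2.
have e1 : m = h + u by lia.
have e2 : h <= u <= h.+1 by lia.
rewrite -hh -hu e1 {hu hh e1} => p0 q0 e.
have low_pq : p * q = (h + u).+1 + p.-1 * q.-1 by nia.
have wl p' q' : 0 < p' -> p' <= q' -> p' + q' = (h + u).+2 ->
    p' * q' + (h.+1 - p') ^ 2 <= h.+1 * u.+1.
  move=> p0' le e'; have [x ex] : exists x, h.+1 = p' + x by exists (h.+1 - p'); lia.
  have -> : h.+1 - p' = x by lia.
  have [y ey] : exists y, u = h + y by exists (u - h); lia.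
  have -> : q' = p' + x + x + y by lia.
  have -> : u.+1 = p' + x + y by lia.
  by rewrite ex; lia.
split.
- apply/andP; split; first by lia.
  by have [le|/ltnW le] := leqP p q; [have := wl p q p0 le e | have := wl q p q0 le]; lia.
- rewrite low_pq => h0; have : p.-1 * q.-1 = 0 by lia.
  by move/eqP; rewrite muln_eq0; lia.
- move=> eq; have [le|/ltnW le] := leqP p q.
    have := wl p q p0 le e; rewrite eq => h0; left.
    have : (h.+1 - p) ^ 2 = 0 by lia.
    by move/eqP; rewrite expn_eq0 andbT => /eqP; lia.
  have := wl q p q0 le; rewrite mulnC eq => h0; right.
  have : (h.+1 - q) ^ 2 = 0 by lia.
  by move/eqP; rewrite expn_eq0 andbT => /eqP; lia.
Qed.

(** * Extremal profiles *)

Section Spectral.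
Variable R : realType.
Local Open Scope ring_scope.

Lemma half_squares_gt0 r : (0 < r)%N -> (0 < half_squares r)%N.
Proof.
move=> r0; have := half_squaresE r; case: (half_squares r) => // e.
have : (0 < r * r.*2.+1 * (7 * r).+1)%N by rewrite !muln_gt0 r0.
by rewrite -e.
Qed.

Lemma spectral_max_profile (V : finType) (G : sgraph V) r lev : (0 < r)%N ->
  leveling G r lev -> ecc_spectral_max G R = Num.sqrt
    (profile_root R (r.*2.+1 ^ 2) (ndeep r lev true) (ndeep r lev false)
       (shallow r lev true) (shallow r lev false)).
Proof.
move=> r0 L; apply: (ecc_spectral_maxE R L) => b.
by have [x [_ h _ _]] := shallow_bounds L b; apply: leq_trans h; apply: half_squares_gt0.
Qed.

Lemma D_spectral_max r a b : (0 < r)%N ->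
  ecc_spectral_max (D r.*2.+1 a b) R =
  Num.sqrt (profile_root R (r.*2.+1 ^ 2) a.+1 b.+1 (half_squares r) (half_squares r)).
Proof.
move=> r0; rewrite (spectral_max_profile r0 (D_leveling a b r0)) !D_ndeep //.
have sh s : shallow r (@D_level r a b) s = half_squares r.
  have [x [_ h1 h2 ex]] := shallow_bounds (D_leveling a b r0) s.
  have x0 : x = 0%N by apply/ex/D_thin.
  by move: h1 h2; rewrite x0; lia.
by rewrite !sh.
Qed.

(** [half_squares_neq] makes the dependence on [p q] strictly monotone, so only one end of the range
    of [p q] competes, and a root equal to the extreme one forces an extreme product. *)
Lemma extremal_profile r m p q :
  (1 < r)%N -> (0 < p)%N -> (0 < q)%N -> (p + q = m.+2)%N ->
  let L p q := profile_root R (r.*2.+1 ^ 2) p q (half_squares r) (half_squares r) in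
  (L p q <= L 1%N m.+1 /\ (L p q = L 1%N m.+1 -> p = 1%N \/ q = 1%N)) \/
  (L p q <= L (m./2).+1 (uphalf m).+1 /\
   (L p q = L (m./2).+1 (uphalf m).+1 -> p = (m./2).+1 \/ q = (m./2).+1)).
Proof.
move=> r1 p0 q0 s L.
have S0 : (0 < half_squares r)%N by apply: half_squares_gt0; lia.
have D0 : (0 < r.*2.+1 ^ 2)%N by rewrite expn_gt0.
have [/andP[t1 t2] c1 c2] := product_bounds p0 q0 s.
have ne := @half_squares_neq r m.+2 r1 isT.
have LC x y : L x y = L y x by rewrite /L profile_rootC.
have [lt|gt] : (half_squares r < m.+2 * r.*2.+1 ^ 2)%N \/ (m.+2 * r.*2.+1 ^ 2 < half_squares r)%N.
  by apply/orP; rewrite -neq_ltn eq_sym; apply/eqP.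
  right; have [et|nt] := eqVneq (p * q)%N ((m./2).+1 * (uphalf m).+1)%N.
    suff -> : L p q = L (m./2).+1 (uphalf m).+1 by split=> // _; apply: c2.
    case: (c2 et) => e.
      by have -> : q = (uphalf m).+1; [lia | rewrite e].
    by have -> : p = (uphalf m).+1; [lia | rewrite e LC].
  have ll : L p q < L (m./2).+1 (uphalf m).+1.
    apply: profile_root_balance => //; first by lia.
    by left; rewrite s; split=> //; rewrite ltn_neqAle nt.
  by split; [exact: ltW | move=> e; move: ll; rewrite e ltxx].
left; have [et|nt] := eqVneq (p * q)%N m.+1.
  suff -> : L p q = L 1%N m.+1 by split=> // _; apply: c1.
  case: (c1 et) => e.
    by have -> : q = m.+1; [lia | rewrite e].
  by have -> : p = m.+1; [lia | rewrite e LC].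
have ll : L p q < L 1%N m.+1.
  apply: profile_root_balance => //.
  by right; rewrite s mul1n; split=> //; rewrite ltn_neqAle eq_sym nt.
by split; [exact: ltW | move=> e; move: ll; rewrite e ltxx].
Qed.

(** One half at a time, the second by the symmetry [profile_rootC]; [leif_trans] combines the
    equality conditions. *)
Lemma profile_root_deepen_both D p q x y S SA SB :
  (0 < D)%N -> (0 < p)%N -> (0 < q)%N -> (0 < S)%N ->
  (S <= SA)%N -> (SA <= S + D * x)%N -> (S <= SB)%N -> (SB <= S + D * y)%N ->
  profile_root R D p q SA SB <= profile_root R D (p + x) (q + y) S S ?= iff
    ((x == 0%N) && (y == 0%N)).
Proof.
move=> D0 p0 q0 S0 A1 A2 B1 B2.
have B0 : (0 < SB)%N := leq_trans S0 B1.
have h1 : profile_root R D p q SA SB <= profile_root R D (p + x) q S SB ?= iff (x == 0%N).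
  case: (posnP x) => [x0|x0].
    rewrite x0 addn0; have -> : SA = S by move: A2; rewrite x0; lia.
    exact: leif_refl.
  have h := profile_root_deepen R D0 p0 q0 S0 B0 x0 A1 A2.
  by split; [exact: ltW | rewrite lt_eqF // gtn_eqF].
have h2 : profile_root R D (p + x) q S SB <= profile_root R D (p + x) (q + y) S S ?= iff (y == 0%N).
  rewrite ![profile_root _ _ (p + x) _ _ _]profile_rootC.
  case: (posnP y) => [y0|y0].
    rewrite y0 addn0; have -> : SB = S by move: B2; rewrite y0; lia.
    exact: leif_refl.
  have px : (0 < p + x)%N by rewrite addn_gt0 p0.
  have h := profile_root_deepen R D0 q0 px S0 S0 y0 B1 B2.
  by split; [exact: ltW | rewrite lt_eqF // gtn_eqF].
exact: leif_trans h1 h2.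
Qed.

End Spectral.

(** * Comparison of a tree with the two double brooms *)

Local Open Scope ring_scope.

Theorem theorem2p5 (R : realType) (n d : nat) (V : finType) (T : sgraph V)
    (hT : is_tree T) (hn : #|V| = n)
    (hd : diam T = d) (hodd : odd d) (hd5 : (5 <= d)%N) :
  let rho := ecc_spectral_max T R in
  let m := (n - d - 1)%N in
  let D1 := D d 0 m in
  let D2 := D d m./2 (uphalf m) in
  let bound := Num.max (ecc_spectral_max D1 R) (ecc_spectral_max D2 R) in
  rho <= bound /\ (rho = bound -> isomorphic T D1 \/ isomorphic T D2).
Proof.
have [r dr] : exists r, d = r.*2.+1 by exists d./2; lia.
move: hd hd5; rewrite {}dr {d hodd} => hd hd5 rho m.
case: hT => -[V0 con] ac; have r1 : (1 < r)%N by lia.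
have r0 : (0 < r)%N by lia.
have [lev L] := tree_leveling con ac V0 hd.
have [x [nx A1 A2 ex]] := shallow_bounds L true.
have [y [ny B1 B2 ey]] := shallow_bounds L false.
have := card_profile r lev; rewrite nx ny hn => en.
have p0 := ndeep_gt0 L true; have q0 := ndeep_gt0 L false.
set p := ndeep r lev true in en p0; set q := ndeep r lev false in en q0.
(* Since [n = p + q + x + y + 2r] with [p, q >= 1], the subtraction [n - d - 1] does not
   truncate. *)
have s : ((p + x) + (q + y) = m.+2)%N by rewrite /m; lia.
have S0 := half_squares_gt0 r0.
have D0 : (0 < r.*2.+1 ^ 2)%N by rewrite expn_gt0.
have h := profile_root_deepen_both R D0 p0 q0 S0 A1 A2 B1 B2.
have rhoE := spectral_max_profile R r0 L.
(* With [x = y = 0] both halves of [T] are thin. If [q] rather than [p] is [a.+1], the leveling of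
   [T] is reversed to match the broom. *)
have iso a b : x = 0%N -> y = 0%N -> (a + b = m)%N -> p = a.+1 \/ q = a.+1 ->
    isomorphic T (D r.*2.+1 a b).
  move=> x0 y0 ab pq.
  have th c : thin_side r lev c by case: c; [apply/ex|apply/ey].
  have thD c : thin_side r (@D_level r a b) c by apply: D_thin.
  case: pq => e.
    apply: (thin_isomorphic L (D_leveling a b r0) th thD) => c.
    by rewrite D_ndeep //; case: c => //; rewrite -/q; lia.
  apply: (thin_isomorphic (leveling_rev L) (D_leveling a b r0) _ thD) => c.
    by apply: (thin_side_rev L); apply: th.
  by rewrite (ndeep_rev L) D_ndeep //; case: c => //=; rewrite -/p; lia.
(* [rho] is compared with the broom through the thin profile [(p + x, q + y)], and the opposite
   inequality forces equality at both stages. That inequality is what [rho = bound] yields for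
   either broom. *)
have step a b : (a + b = m)%N ->
    let L p q := profile_root R (r.*2.+1 ^ 2) p q (half_squares r) (half_squares r) in
    L (p + x)%N (q + y)%N <= L a.+1 b.+1 ->
    (L (p + x)%N (q + y)%N = L a.+1 b.+1 -> (p + x)%N = a.+1 \/ (q + y)%N = a.+1) ->
    rho <= ecc_spectral_max (D r.*2.+1 a b) R /\
    (ecc_spectral_max (D r.*2.+1 a b) R <= rho -> isomorphic T (D r.*2.+1 a b)).
  move=> ab LL le eqc; rewrite /rho rhoE D_spectral_max // -/(LL _ _).
  have LT := le_trans (leif_le h) le.
  have Lab : 0 < LL a.+1 b.+1 by apply: profile_root_gt0.
  have LT0 : 0 < profile_root R (r.*2.+1 ^ 2) p q (shallow r lev true) (shallow r lev false).
    by apply: profile_root_gt0 => //; apply: leq_trans S0 _.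
  split; first by rewrite ler_sqrt // ltW.
  rewrite ler_sqrt ?(ltW LT0) // => ge.
  have e2 : LL (p + x)%N (q + y)%N = LL a.+1 b.+1.
    by apply: le_anti; rewrite le (le_trans ge (leif_le h)).
  have /eqP : profile_root R (r.*2.+1 ^ 2) p q (shallow r lev true) (shallow r lev false) =
      LL (p + x)%N (q + y)%N.
    by apply: le_anti; rewrite (leif_le h) e2 ge.
  rewrite h.2 => /andP[/eqP x0 /eqP y0].
  by apply: iso => //; have := eqc e2; rewrite x0 y0 !addn0.
move=> D1 D2 bound.
have pe : (0 < p + x)%N by rewrite addn_gt0 p0.
have qe : (0 < q + y)%N by rewrite addn_gt0 q0.
case: (extremal_profile R r1 pe qe s) => -[le eqc].
  have [h1 h2] := step 0%N m (add0n m) le eqc.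
  split; first by rewrite le_max h1.
  by move=> e; left; apply: h2; rewrite e le_max lexx.
have mm : (m./2 + uphalf m = m)%N by lia.
have [h1 h2] := step _ _ mm le eqc.
split; first by rewrite le_max h1 orbT.
by move=> e; right; apply: h2; rewrite e le_max lexx orbT.
Qed.
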